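(* Let $p$ be a prime, let $n\ge 1$ be an integer, let $n_p$ be the largest power of $p$ dividing $n$, and put $e=n_p$. Let $y\in\mathbb{F}_{p^n}$ be such that the polynomial $t^p-t-y$ is reducible over $\mathbb{F}_{p^n}$. Then there exists $z\in\mathbb{F}_{p^e}\subseteq\mathbb{F}_{p^n}$ such that the roots of $t^p-t-y$ are exactly the elements $x+u$ with $u\in\mathbb{F}_p$, where $$x=\sum_{i=0}^{n-1}\sum_{j=0}^{i-1}z^{p^j}y^{p^i},$$ and furthermore the sequence $\left(\sum_{j=0}^{i-1}z^{p^j}\right)_{i\ge0}$ is periodic with period $pe$.
   Context: Empty sums are $0$. A sequence $(x_i)_{i\ge0}$ has period $m$ if $x_i=x_j$ whenever $i\equiv j\pmod m$, and $m$ is the minimal positive integer with this property. *)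

(* Defs.v *)
From mathcomp Require Import all_boot all_order all_algebra all_field.

Set Implicit Arguments.
Unset Strict Implicit.
Unset Printing Implicit Defensive.

Import GRing.Theory.
Local Open Scope ring_scope.

Definition periodic_mod (T : Type) (s : nat -> T) (m : nat) : Prop :=
  forall i j : nat, i = j %[mod m] -> s i = s j.

Definition has_period (T : Type) (s : nat -> T) (m : nat) : Prop :=
  [/\ (0 < m)%N, periodic_mod s m
    & forall k : nat, (0 < k)%N -> periodic_mod s k -> (m <= k)%N].

(* In a field, [divring_closed] (contains 1, closed under subtraction and
   division) says exactly that [K] is a subfield.  A finite field has at most
   one subfield of each order. *)
Definition subfield_of_order (F : finFieldType) (q : nat) (K : {set F}) : Prop :=
  GRing.divring_closed (mem K) /\ #|K| = q.

(* Main.v *)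
Require Import Defs.
From mathcomp Require Import all_boot all_order all_algebra all_field.
From mathcomp Require Import ring.

Set Implicit Arguments.
Unset Strict Implicit.
Unset Printing Implicit Defensive.

Import GRing.Theory.
Local Open Scope ring_scope.

(** Write [T_k(x) = x + x^p + ... + x^(p^(k-1))].  If [T_n(y) = 0] and
    [T_n(z) = 1], then [x = \sum_(i < n) T_i(z) y^(p^i)] telescopes under
    Frobenius to [x^p = x + y].  If [T_n(y) <> 0], then [t^p - t - y] is
    irreducible: modulo a divisor, [t^(p^n)] is [t + T_n(y)], so the divisor is
    translation invariant and has degree [0] or at least [p].  Since [n / e] is
    prime to [p], an element [z] with [T_n(z) = 1] already exists in the
    subfield of order [p^e]; then [T_(i+e)(z) = T_i(z) + T_e(z)] with
    [T_e(z) <> 0], and this gives the period [p e]. *)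

(** * Frobenius powers and partial traces *)

Lemma exprD_pcharX (R : comNzRingType) (p k : nat) (x y : R) :
  p \in [pchar R] -> (x + y) ^+ (p ^ k) = x ^+ (p ^ k) + y ^+ (p ^ k).
Proof.
by move=> pR; rewrite exprDn_pchar // pnatX pnatE ?pR ?(pcharf_prime pR).
Qed.

Lemma exprB_pcharX (R : comNzRingType) (p k : nat) (x y : R) :
  p \in [pchar R] -> (x - y) ^+ (p ^ k) = x ^+ (p ^ k) - y ^+ (p ^ k).
Proof.
move=> pR; apply: (addIr (y ^+ (p ^ k))).
by rewrite -exprD_pcharX // !subrK.
Qed.

Lemma expr_sum_pcharX (R : comNzRingType) (p k : nat) (I : Type) (r : seq I)
    (P : pred I) (E : I -> R) : p \in [pchar R] ->
  (\sum_(i <- r | P i) E i) ^+ (p ^ k) = \sum_(i <- r | P i) E i ^+ (p ^ k).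
Proof.
move=> pR; elim/big_rec2: _ => [|i a b _ <-]; last by rewrite exprD_pcharX.
by rewrite expr0n expn_eq0 (negPf (lt0n_neq0 (prime_gt0 (pcharf_prime pR)))).
Qed.

(** On a field of order [p ^ k] this is the absolute trace. A general ring is allowed so that [x]
    may also be the polynomial ['X]. *)
Definition ptrace (R : comNzRingType) (p k : nat) (x : R) : R :=
  \sum_(j < k) x ^+ (p ^ j).

Lemma ptrace0 (R : comNzRingType) (p : nat) (x : R) : ptrace p 0 x = 0.
Proof. exact: big_ord0. Qed.

Lemma ptraceS (R : comNzRingType) (p k : nat) (x : R) :
  ptrace p k.+1 x = ptrace p k x + x ^+ (p ^ k).
Proof. exact: big_ord_recr. Qed.

Lemma ptraceD (R : comNzRingType) (p k l : nat) (x : R) :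
  ptrace p (k + l) x = ptrace p k x + ptrace p l (x ^+ (p ^ k)).
Proof.
rewrite /ptrace big_split_ord; congr (_ + _).
by apply: eq_bigr => i _ /=; rewrite expnD exprM.
Qed.

Lemma expr_fixedX (R : comNzRingType) (q k : nat) (x : R) :
  x ^+ q = x -> x ^+ (q ^ k) = x.
Proof. by move=> xq; elim: k => // k IH; rewrite expnS exprM xq. Qed.

Lemma ptrace_expr (R : comNzRingType) (p k : nat) (x : R) : p \in [pchar R] ->
  ptrace p k x ^+ p = ptrace p k.+1 x - x.
Proof.
move=> pR; rewrite -[X in _ ^+ X]expn1 expr_sum_pcharX // /ptrace big_ord_recl.
rewrite expn0 expr1 addrC addKr; apply: eq_bigr => i _ /=.
by rewrite -exprM -expnD addn1.
Qed.

Lemma ptrace_fixed (R : comNzRingType) (p k : nat) (x : R) : p \in [pchar R] ->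
  x ^+ (p ^ k) = x -> ptrace p k x ^+ p = ptrace p k x.
Proof. by move=> pR xk; rewrite ptrace_expr // ptraceS xk addrK. Qed.

Lemma ptrace_scale (R : comNzRingType) (p k : nat) (a x : R) :
  a ^+ p = a -> ptrace p k (a * x) = a * ptrace p k x.
Proof.
move=> ap; rewrite mulr_sumr; apply: eq_bigr => i _.
by rewrite exprMn (expr_fixedX _ ap).
Qed.

Lemma ptraceMn (R : comNzRingType) (p e k : nat) (x : R) :
  x ^+ (p ^ e) = x -> ptrace p (e * k) x = ptrace p e x *+ k.
Proof.
move=> xe; elim: k => [|k IH]; first by rewrite muln0 ptrace0.
by rewrite mulnS ptraceD xe IH mulrS.
Qed.

(** * The prime field and translations of polynomials *)

Lemma natr_inj_pchar (R : nzRingType) (p i j : nat) : p \in [pchar R] ->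
  (i < p)%N -> (j < p)%N -> i%:R = j%:R :> R -> i = j.
Proof.
move=> pR; wlog ij : i j / (i <= j)%N => [H ip jp e|_ jp e].
  by case/orP: (leq_total i j) => ij; [|apply/esym]; apply: H.
apply/eqP; rewrite eqn_leq ij -subn_eq0 /=.
have pd : (p %| j - i)%N by rewrite (dvdn_pcharf pR) natrB // e subrr.
move: pd (leq_ltn_trans (leq_subr i j) jp).
by case: posnP => // ? pd; rewrite ltnNge dvdn_leq.
Qed.

Lemma size_Xn_sub (R : nzRingType) (m : nat) (r : {poly R}) :
  (size r <= m)%N -> size ('X^m - r) = m.+1.
Proof. by move=> h; rewrite size_polyDl size_polyXn // size_polyN. Qed.

(** The [p] multiples of 1 are already roots of ['X^p - 'X], so one more root would exceed its
    degree. *)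
Lemma fixed_pchar (R : idomainType) (p : nat) (a : R) : p \in [pchar R] ->
  a ^+ p = a -> exists2 i, (i < p)%N & a = i%:R.
Proof.
move=> pR ap; have p_gt1 := prime_gt1 (pcharf_prime pR).
pose s := [seq i%:R : R | i <- iota 0 p].
case: (boolP (a \in s)) => [/mapP[i]|a_s].
  by rewrite mem_iota => /andP[_ ip] ->; exists i.
have szf : size ('X^p - 'X : {poly R}) = p.+1 by rewrite size_Xn_sub ?size_polyX.
have : (size (a :: s) < size ('X^p - 'X : {poly R})%R)%N.
  apply: max_poly_roots; first by rewrite -size_poly_eq0 szf.
    rewrite /= /root !hornerE ap subrr eqxx /=.
    apply/allP => _ /mapP[i _ ->].
    by rewrite /root !hornerE -(pFrobenius_autE pR) pFrobenius_aut_nat subrr.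
  rewrite /= a_s map_inj_in_uniq ?iota_uniq // => i j.
  by rewrite !mem_iota /= !add0n; exact: natr_inj_pchar.
by rewrite szf /= size_map size_iota ltnn.
Qed.

(* An invariance under a nontrivial translation forces [q - q(0)] to vanish on
   the [p] multiples of [c]. *)
Lemma size_translation_invariant (R : idomainType) (p : nat) (c : R)
    (q : {poly R}) : p \in [pchar R] -> c != 0 ->
  q \Po ('X + c%:P) = q -> (size q <= p)%N -> (size q <= 1)%N.
Proof.
move=> pR c0 qc qp; have p_gt1 := prime_gt1 (pcharf_prime pR).
have qi i : q.[c * i%:R] = q.[0].
  elim: i => [|i IH]; first by rewrite mulr0.
  by rewrite -IH -[in RHS]qc horner_comp !hornerE -natr1 mulrDr mulr1.
suff: q - (q.[0])%:P == 0.
  by rewrite subr_eq0 => /eqP->; exact: size_polyC_leq1.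
apply/negP => /negP q0.
have : (size [seq (c * i%:R)%R | i <- iota 0 p] < size (q - (q.[0])%:P)%R)%N.
  apply: max_poly_roots => //.
    by apply/allP => _ /mapP[i _ ->]; rewrite /root !hornerE qi subrr.
  rewrite map_inj_in_uniq ?iota_uniq // => i j.
  rewrite !mem_iota /= !add0n => ip jp /(mulfI c0); exact: natr_inj_pchar ip jp.
rewrite size_map size_iota ltnNge => /negP; apply.
apply: leq_trans (size_polyD _ _) _; rewrite geq_max qp size_polyN.
by apply: leq_trans (size_polyC_leq1 _) (ltnW p_gt1).
Qed.

(** * Irreducibility when the trace is nonzero *)

Lemma dvdp_subXX (R : idomainType) (a b : {poly R}) m : a - b %| a ^+ m - b ^+ m.
Proof. by rewrite subrXX dvdp_mulr. Qed.

Lemma dvdp_sub_comp (R : idomainType) (q a b : {poly R}) :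
  a - b %| (q \Po a) - (q \Po b).
Proof.
rewrite !comp_polyE -sumrB.
apply: (big_ind (fun r => a - b %| r)) => [|r s|i _]; first exact: dvdp0.
  exact: dvdp_add.
by rewrite -scalerBr -mul_polyC dvdp_mull // dvdp_subXX.
Qed.

(** Modulo the divisor, ['X^p] is ['X + y%:P]; each further [p]-th power raises the conjugates of
    [y] and adds a new [y]. *)
Lemma artin_schreier_XX (F : fieldType) (p k : nat) (y : F) : p \in [pchar F] ->
  'X^p - 'X - y%:P %| 'X^(p ^ k) - ('X + (ptrace p k y)%:P).
Proof.
move=> pF; have pP : p \in [pchar {poly F}] by rewrite pchar_poly.
elim: k => [|k IH]; first by rewrite ptrace0 addr0 subrr dvdp0.
rewrite expnSr exprM.
have -> : 'X^(p ^ k) ^+ p - ('X + (ptrace p k.+1 y)%:P)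
   = ('X^(p ^ k) ^+ p - ('X + (ptrace p k y)%:P) ^+ p) + ('X^p - 'X - y%:P).
  rewrite -[in ('X + _) ^+ p](expn1 p) exprD_pcharX // expn1 -polyC_exp.
  rewrite ptrace_expr // polyCB; ring.
by apply: dvdp_add => //; apply: dvdp_trans IH _; exact: dvdp_subXX.
Qed.

Lemma expr_card_poly (F : finFieldType) (p n : nat) (q : {poly F}) :
  p \in [pchar F] -> #|F| = (p ^ n)%N -> q ^+ (p ^ n) = q \Po 'X^(p ^ n).
Proof.
move=> pF cF; have pP : p \in [pchar {poly F}] by rewrite pchar_poly.
rewrite comp_polyE -[in LHS](coefK q) poly_def expr_sum_pcharX //.
by apply: eq_bigr => i _; rewrite exprZn -{1}cF expf_card exprAC.
Qed.

Lemma artin_schreier_irreducible (F : finFieldType) (p n : nat) (y : F) :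
  p \in [pchar F] -> #|F| = (p ^ n)%N -> ptrace p n y != 0 ->
  irreducible_poly ('X^p - 'X - y%:P).
Proof.
move=> pF cF c0; have p_gt1 := prime_gt1 (pcharf_prime pF).
set f := 'X^p - 'X - y%:P; set c := ptrace p n y in c0.
have szf : size f = p.+1.
  rewrite /f -addrA -opprD size_Xn_sub // size_polyDl size_polyX //.
  by apply: leq_ltn_trans (size_polyC_leq1 _) _.
have f0 : f != 0 by rewrite -size_poly_eq0 szf.
split=> [|q q1 qf]; first by rewrite szf ltnS ltnW.
have q0 : q != 0 by apply: contraNneq f0 => q0; move: qf; rewrite q0 dvd0p.
rewrite -dvdp_size_eqp // eqn_leq dvdp_leq //= szf ltnNge; apply/negP => qp.
have szc : size ('X + c%:P) = 2 by rewrite size_XaddC.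
(* [q] divides [q ^+ (p ^ n)], which is [q \Po 'X^(p ^ n)], and modulo [q] the power ['X^(p ^ n)] is
   ['X + c%:P]. *)
have qqc : q %| q \Po ('X + c%:P).
  have: q %| (q \Po 'X^(p ^ n)) - (q \Po ('X + c%:P)).
    apply: dvdp_trans qf (dvdp_trans _ (dvdp_sub_comp _ _ _)).
    exact: artin_schreier_XX.
  by rewrite -expr_card_poly // dvdp_subr // dvdp_exp // expn_gt0 ltnW.
(* Equal sizes make [q] and its translate proportional; equal leading coefficients then make them
   equal. *)
have qc : q \Po ('X + c%:P) = q.
  have: q %= q \Po ('X + c%:P) by rewrite -dvdp_size_eqp // size_comp_poly2.
  move/eqp_eq; rewrite lead_coef_comp ?szc // lead_coefXaddC expr1n mulr1.
  by move/(scalerI _) => <- //; rewrite lead_coef_eq0.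
have := size_translation_invariant pF c0 qc qp.
by rewrite leq_eqVlt (negPf q1) ltnS leqn0 size_poly_eq0 (negPf q0).
Qed.

(** * The subfield of order [p ^ e] and its trace *)

(** ['X^#|F| - 'X] is the product of the distinct factors ['X - a%:P], so [f] is a subproduct up to
    a unit. *)
Lemma card_roots_dvd (F : finFieldType) (f : {poly F}) :
  f %| 'X^#|F| - 'X -> #|[set x | root f x]| = (size f).-1.
Proof.
rewrite finField_genPoly => /dvdp_prod_XsubC[m fm].
rewrite (eqp_size fm) size_prod_XsubC /= -(card_uniqP _).
  by apply: eq_card => x; rewrite inE (eqp_root fm) root_prod_XsubC.
by rewrite mask_uniq // index_enum_uniq.
Qed.

Lemma dvdp_Xq_sub (R : idomainType) (q k : nat) :
  'X^q - 'X %| ('X^(q ^ k) - 'X : {poly R}).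
Proof.
elim: k => [|k IH]; first by rewrite subrr dvdp0.
have -> : 'X^(q ^ k.+1) - 'X = ('X^(q ^ k) ^+ q - 'X^q) + ('X^q - 'X) :> {poly R}.
  by rewrite expnSr exprM addrA subrK.
by rewrite dvdp_add // (dvdp_trans IH) // dvdp_subXX.
Qed.

Definition frob_fixed (F : finFieldType) (q : nat) : {set F} :=
  [set x | x ^+ q == x].

Lemma frob_fixed_subfield (F : finFieldType) (p n e : nat) :
  prime p -> #|F| = (p ^ n)%N -> (0 < e)%N -> (e %| n)%N ->
  subfield_of_order (p ^ e) (frob_fixed F (p ^ e)).
Proof.
move=> pp cF e0 en; have pF := card_finPcharP cF pp.
have pe1 : (1 < p ^ e)%N by rewrite (ltn_exp2l 0) // prime_gt1.
split.
  split=> [|x y|x y]; rewrite !inE ?expr1n // => /eqP xe /eqP ye.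
    by rewrite exprB_pcharX // xe ye.
  by rewrite expr_div_n xe ye.
have szf : size ('X^(p ^ e) - 'X : {poly F}) = (p ^ e).+1.
  by rewrite size_Xn_sub ?size_polyX.
have -> : frob_fixed F (p ^ e) = [set x | root ('X^(p ^ e) - 'X) x].
  by apply/setP=> x; rewrite !inE /root !hornerE subr_eq0.
rewrite card_roots_dvd ?szf // cF -(divnK en) mulnC expnM; exact: dvdp_Xq_sub.
Qed.

Lemma size_ptraceX (F : fieldType) (p k : nat) : (1 < p)%N ->
  size (ptrace p k.+1 'X : {poly F}) = (p ^ k).+1.
Proof.
move=> p1; elim: k => [|k IH].
  by rewrite ptraceS ptrace0 add0r size_polyX.
by rewrite ptraceS addrC size_polyDl size_polyXn // IH ltnS ltn_exp2l.
Qed.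

Lemma horner_ptraceX (F : fieldType) (p k : nat) (x : F) :
  (ptrace p k 'X).[x] = ptrace p k x.
Proof. by rewrite horner_sum; apply: eq_bigr => j _; rewrite hornerXn. Qed.

(** As a polynomial the trace has degree [p ^ (e - 1)], too small to vanish on all of [K]. *)
Lemma ptrace_neq0 (F : finFieldType) (p e : nat) (K : {set F}) :
  (1 < p)%N -> (0 < e)%N -> #|K| = (p ^ e)%N ->
  exists2 w, w \in K & ptrace p e w != 0.
Proof.
case: e => // e p1 _ cK; apply/exists_inP; apply: contra_eqT cK => /exists_inPn K0.
have szT := size_ptraceX F e p1.
have: (size (enum K) < size (ptrace p e.+1 'X : {poly F})%R)%N.
  apply: max_poly_roots; rewrite ?enum_uniq //; first by rewrite -size_poly_eq0 szT.
  apply/allP => x; rewrite mem_enum => /K0.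
  by rewrite negbK /root horner_ptraceX.
rewrite -cardE szT ltnS neq_ltn => /leq_ltn_trans->//.
by rewrite ltn_exp2l.
Qed.

(** * The period of the partial traces *)

(** A full block of [p * e] terms sums to [p] times [ptrace p e z], which is zero. *)
Lemma periodic_ptrace (R : comNzRingType) (p e : nat) (z : R) :
  p \in [pchar R] -> z ^+ (p ^ e) = z ->
  periodic_mod (fun i => ptrace p i z) (p * e).
Proof.
move=> pR ze i j ij.
have mod_pe m : ptrace p m z = ptrace p (m %% (p * e)) z.
  rewrite {1}(divn_eq m (p * e)) mulnC [(p * e)%N]mulnC -mulnA ptraceD.
  rewrite ptraceMn // mulrnA (mulrn_pchar pR) mul0rn add0r.
  by rewrite expnM (expr_fixedX _ ze).
by rewrite mod_pe ij -mod_pe.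
Qed.

(* The multiples of a period [k] meet every multiple of [gcd(k, p^(a+1))] modulo
   [p^(a+1)], so if [p^(a+1)] did not divide [k] they would reach [p^a], where
   the sequence does not vanish. *)
Lemma has_period_ptrace (R : comNzRingType) (p a : nat) (z : R) :
  p \in [pchar R] -> z ^+ (p ^ (p ^ a)) = z -> ptrace p (p ^ a) z != 0 ->
  has_period (fun i => ptrace p i z) (p * p ^ a).
Proof.
move=> pR ze tz; have pp := pcharf_prime pR.
have per := periodic_ptrace pR ze.
split=> // [|k k0 perk]; first by rewrite -expnS expn_gt0 prime_gt0.
rewrite -expnS in per *; rewrite leqNgt; apply: contraNN tz => kp.
have /(dvdn_pfactor _ _ pp)[b ba gE] := dvdn_gcdr k (p ^ a.+1).
have {}ba : (b <= a)%N.
  rewrite -ltnS ltn_neqAle ba andbT; apply: contraTneq kp => bE.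
  by rewrite -leqNgt dvdn_leq // -bE -gE dvdn_gcdl.
(* Bezout scaled by [p ^ (a - b)] yields a multiple of [k] congruent to [p ^ a] modulo
   [p ^ a.+1]. *)
have [u v uv _] := egcdnP (p ^ a.+1) k0.
have -> : ptrace p (p ^ a) z = ptrace p (u * p ^ (a - b) * k) z.
  apply: per; rewrite mulnAC uv gE mulnDl -expnD subnKC // mulnAC.
  by rewrite modnMDl.
by rewrite (perk _ 0%N) ?ptrace0 // modnMl mod0n.
Qed.

(** * The explicit root and the conclusion *)

Lemma artin_schreier_solution (R : comNzRingType) (p n : nat) (y z : R) :
  p \in [pchar R] -> y ^+ (p ^ n) = y -> ptrace p n y = 0 -> ptrace p n z = 1 ->
  let x := \sum_(i < n) ptrace p i z * y ^+ (p ^ i) in x ^+ p = x + y.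
Proof.
move=> pR yn ty tz x; pose g i := ptrace p i z * y ^+ (p ^ i).
(* Shifting the index drops [g 0 = 0] and gains [g n = y]. *)
have <- : \sum_(i < n) g i.+1 = x + y.
  have : \sum_(i < n.+1) g i = x + g n by exact: big_ord_recr.
  by rewrite big_ord_recl /g /= ptrace0 mul0r add0r tz mul1r yn.
have yS : \sum_(i < n) y ^+ (p ^ i.+1) = 0.
  have := ptrace_fixed pR yn.
  rewrite ptrace_expr // ty /ptrace big_ord_recl expn0 expr1 addrC addKr.
  exact.
(* The [p]-th power of [g i] is [g i.+1] minus this correction; the corrections cancel in total by
   [yS]. *)
have -> : \sum_(i < n) g i.+1 = \sum_(i < n) (g i.+1 - z * y ^+ (p ^ i.+1)).
  by rewrite sumrB -mulr_sumr yS mulr0 subr0.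
rewrite -[X in _ ^+ X]expn1 expr_sum_pcharX //.
apply: eq_bigr => i _; rewrite expn1 exprMn ptrace_expr // -exprM -expnSr.
by rewrite /g mulrBl.
Qed.

(** The difference of two roots is fixed by Frobenius, hence lies in the prime field. *)
Lemma artin_schreier_roots (R : idomainType) (p : nat) (x y r : R) :
  p \in [pchar R] -> x ^+ p = x + y ->
  root ('X^p - 'X - y%:P) r <-> exists u : 'F_p, r = x + (nat_of_ord u)%:R.
Proof.
move=> pR xp; have pp := pcharf_prime pR; rewrite /root !hornerE.
split=> [/eqP rp|[u ->]].
  have [|i ip rx] := @fixed_pchar R p (r - x) pR.
    rewrite -[X in _ ^+ X]expn1 exprB_pcharX // expn1 xp; apply/eqP.
    by rewrite -subr_eq0 -rp; apply/eqP; ring.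
  by exists (i%:R); rewrite val_Fp_nat // modn_small // -rx addrC subrK.
rewrite -[X in _ ^+ X]expn1 exprD_pcharX // expn1 xp.
by rewrite -(pFrobenius_autE pR) pFrobenius_aut_nat; apply/eqP; ring.
Qed.

Theorem mainTheorem3 (p n : nat) (F : finFieldType) (y : F) :
  prime p -> (1 <= n)%N -> #|F| = (p ^ n)%N ->
  ~ irreducible_poly ('X^p - 'X - y%:P) ->
  let e := (n`_p)%N in
  exists (K : {set F}) (z : F),
    [/\ subfield_of_order (p ^ e) K,
        z \in K,
        let x := \sum_(i < n) \sum_(j < i) z ^+ (p ^ j) * y ^+ (p ^ i) in
        forall r : F, root ('X^p - 'X - y%:P) r <->
          exists u : 'F_p, r = x + (nat_of_ord u)%:R
      & has_period (fun i : nat => \sum_(j < i) z ^+ (p ^ j)) (p * e)].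
Proof.
move=> pp n0 cF red e; have pF := card_finPcharP cF pp.
have e0 : (0 < e)%N by rewrite part_gt0.
have en : (e %| n)%N := dvdn_part p n.
have Ksub := frob_fixed_subfield pp cF e0 en.
have [w wK tw] := ptrace_neq0 (prime_gt1 pp) e0 Ksub.2.
have we : w ^+ (p ^ e) = w by move: wK; rewrite inE => /eqP.
have fixF v : v ^+ (p ^ n) = v :> F by rewrite -cF expf_card.
(* The trace of [w] over the prime field is [n / e] times its trace from the
   subfield, and [n / e] is prime to [p]. *)
have twn : ptrace p n w != 0.
  rewrite -(divnK en) mulnC ptraceMn // -mulr_natr mulf_neq0 //.
  rewrite -(dvdn_pcharf pF) dvdn_divRL // /e p_part -expnS.
  by rewrite pfactor_dvdn // ltnn.
(* The trace of [w] lies in the prime field, so rescaling to trace 1 stays inside the subfield. *)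
pose a := (ptrace p n w)^-1; pose z := a * w.
have ap : a ^+ p = a by rewrite exprVn ptrace_fixed.
have ze : z ^+ (p ^ e) = z by rewrite exprMn we (expr_fixedX _ ap).
have tz : ptrace p n z = 1 by rewrite ptrace_scale // mulVf.
have ty : ptrace p n y = 0.
  by apply/eqP; apply: contra_notT red; exact: artin_schreier_irreducible.
exists (frob_fixed F (p ^ e)), z; split=> //; first by rewrite inE ze.
  move=> x r; apply: artin_schreier_roots => //.
  have -> : x = \sum_(i < n) ptrace p i z * y ^+ (p ^ i).
    by apply: eq_bigr => i _; rewrite mulr_suml.
  exact: artin_schreier_solution.
have eE : e = (p ^ logn p n)%N by rewrite /e p_part.
rewrite eE; apply: has_period_ptrace => //; rewrite -eE //.
(* [ptrace p n z] is a multiple of [ptrace p e z], so the latter cannot vanish. *)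
apply: contra_eq_neq tz => tz.
by rewrite -(divnK en) mulnC ptraceMn // tz mul0rn eq_sym oner_eq0.
Qed.
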